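(* Let $t>7$ be odd, $f=2$ and $d=1$. Divide the $t$ coins into six piles $A,\bar A,B,\bar B,C,\bar C$ of sizes $$|A|=\lfloor t/2\rfloor-2,\quad |\bar A|=\lfloor t/2\rfloor-3,\quad |B|=1,\quad |\bar B|=2,\quad |C|=2,\quad |\bar C|=1,$$ where the two fake coins are placed one in $A$ and one in $\bar A$, or one in $B$ and one in $\bar B$, or one in $C$ and one in $\bar C$. The lawyer performs two weighings: first $A\cup B$ against $\bar A\cup\bar B$, then $B\cup C$ against $\bar B\cup\bar C$. Then this is a discreet strategy for the parameters $(t,2,1)$.
   Context: There are $t$ distinguishable coins, identified with a set $T$ with $|T|=t$. All real coins weigh the same, all fake coins weigh the same, and a fake coin is lighter than a real one. Exactly $f$ coins are fake; the lawyer knows the true set $F\subset T$ of fake coins, $|F|=f$. The judge only knows in advance that the number of fake coins is either $f$ or $d$. A weighing places $n\ge 1$ coins on the left pan and $n$ other coins on the right pan of a balance scale; its outcome is one of ''balanced'', ''left pan lighter'', ''right pan lighter'' (the pan with more fake coins is lighter; the pans balance if they contain equally many fake coins). For a finite sequence of weighings performed with true fake set $F$, a set $S\subseteq T$ is consistent if, were $S$ the set of fake coins, every weighing would have the same outcome as it has for $F$. A strategy for $(t,f,d)$ is a choice of $F$ with $|F|=f$ and a finite sequence of weighings that proves to the judge that there are exactly $f$ fake coins, i.e. no set $S$ with $|S|=d$ is consistent. It is discreet if no information about any particular coin is revealed: for every coin $c\in T$ there is a consistent set $S$ with $|S|=f$ and $c\in S$, and also a consistent set $S'$ with $|S'|=f$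 and $c\notin S'$. *)

(* Defs.v *)
From mathcomp Require Import all_boot.

Set Implicit Arguments.
Unset Strict Implicit.
Unset Printing Implicit Defensive.

Section Coins.

Variable T : finType.

Implicit Types (F S X Y : {set T}) (piles : seq {set T}).

(* A pair (left pan, right pan). *)
Definition weighing : Type := ({set T} * {set T})%type.

Implicit Types (w : weighing) (ws : seq weighing).

Definition legal_weighing w : Prop :=
  [/\ 1 <= #|w.1|, #|w.1| = #|w.2| & [disjoint w.1 & w.2]].

Inductive outcome : Type := Balanced | LeftLighter | RightLighter.

(* Fake coins are lighter and both pans hold the same number of coins, so the
   lighter pan is the one with more fake coins. *)
Definition weigh S w : outcome :=
  if #|S :&: w.1| == #|S :&: w.2| then Balanced
  else if #|S :&: w.2| < #|S :&: w.1| then LeftLighter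
  else RightLighter.

Definition consistent F ws S : Prop :=
  forall w, w \in ws -> weigh S w = weigh F w.

Definition strategy (t f d : nat) F ws : Prop :=
  [/\ #|T| = t,
      #|F| = f,
      forall w, w \in ws -> legal_weighing w
    & forall S, #|S| = d -> ~ consistent F ws S].

Definition discreet (f : nat) F ws : Prop :=
  forall c : T,
    (exists S, [/\ #|S| = f, consistent F ws S & c \in S]) /\
    (exists S, [/\ #|S| = f, consistent F ws S & c \notin S]).

Definition discreet_strategy (t f d : nat) F ws : Prop :=
  strategy t f d F ws /\ discreet f F ws.

(* A list rather than a set of sets, so that two equal nonempty piles are
   rejected instead of being merged. *)
Definition divided_into piles : Prop :=
  pairwise (fun X Y => [disjoint X & Y]) piles /\
  \bigcup_(X <- piles) X = [set: T].

Definition one_in_each F X Y : Prop :=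
  exists x y, [/\ x \in X, y \in Y & F = [set x; y]].

End Coins.

(* Main.v *)
Require Import Defs.
From mathcomp Require Import all_boot.
From mathcomp Require Import zify.

Set Implicit Arguments.
Unset Strict Implicit.
Unset Printing Implicit Defensive.

(** Call [A] and [A'], [B] and [B'], [C] and [C'] partner piles.  In each
    weighing, partner piles are either on opposite pans or both off the scale,
    so two fake coins in partner piles make it balance ([weigh_pair_balanced]):
    all pairs of coins from partner piles are consistent with one another.  As
    there are three pairs of partner piles and no pile is empty, every coin
    belongs to one such pair of coins and is missed by another, hence no
    information about it is revealed.  On the other hand every coin takes part
    in at least one of the two weighings, which a single fake coin would tip
    ([weigh_single_tips]), so one fake coin cannot produce two balanced
    outcomes. *)

Section Coins.

Variable T : finType.
Implicit Types (x y c : T) (X Y Z W L R S : {set T}) (ps : seq {set T}).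

Lemma in_bigcup_seq ps c :
  (c \in \bigcup_(X <- ps) X) = has (fun X => c \in X) ps.
Proof.
by elim: ps => [|X ps IHps]; rewrite ?big_nil ?big_cons inE //= IHps.
Qed.

(** Phrasing a division into piles as a count makes every question about the
    pans that hold a given coin a finite case analysis on booleans. *)
Lemma count_divided_into ps c :
  divided_into ps -> count (fun X => c \in X) ps = 1.
Proof.
case=> disj cover.
have: has (fun X => c \in X) ps by rewrite -in_bigcup_seq cover inE.
elim: ps disj {cover} => //= X ps IHps /andP[/allP disjX disj].
have [cX _ | _ /(IHps disj)-> //] := boolP (c \in X).
suff /negPf noc: ~~ has (fun X => c \in X) ps.
  by move: noc; rewrite has_count lt0n => /negbFE/eqP->.
by apply/hasPn=> Y /disjX disjXY; rewrite (disjointFr disjXY cX).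
Qed.

Lemma disjoint_pointwise X Y :
  (forall c, ~~ ((c \in X) && (c \in Y))) -> [disjoint X & Y].
Proof. by move=> no_c; apply/pred0P=> c; apply/negbTE/no_c. Qed.

Lemma card_disjointU X Y : [disjoint X & Y] -> #|X :|: Y| = #|X| + #|Y|.
Proof. by move=> /disjoint_setI0 XY0; rewrite cardsU XY0 cards0 subn0. Qed.

Lemma legal_weighing_unions X Y Z W :
    (forall c, (c \in X) + (c \in Y) + (c \in Z) + (c \in W) <= 1) ->
    0 < #|X| + #|Y| -> #|X| + #|Y| = #|Z| + #|W| ->
  legal_weighing (X :|: Y, Z :|: W).
Proof.
move=> once pos eqXY_ZW; rewrite /legal_weighing /= !card_disjointU //.
- split=> //; apply: disjoint_pointwise => c; move: (once c); rewrite !inE.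
  by do 4!case: (c \in _).
- by apply: disjoint_pointwise => c; move: (once c); do 4!case: (c \in _).
- by apply: disjoint_pointwise => c; move: (once c); do 4!case: (c \in _).
Qed.

Lemma weigh_balancedE S L R :
  weigh S (L, R) = Balanced <-> #|S :&: L| = #|S :&: R|.
Proof. by rewrite /weigh /=; case: eqP => // neq; case: ifP. Qed.

Lemma card_set1I x X : #|[set x] :&: X| = (x \in X).
Proof.
case: (boolP (x \in X)) => xX; first by rewrite (setIidPl _) ?sub1set ?cards1.
by apply/eqP; rewrite cards_eq0 setI_eq0 disjoints1.
Qed.

Lemma card_set2I x y X :
  x != y -> #|[set x; y] :&: X| = (x \in X) + (y \in X).
Proof.
move=> neq_xy; rewrite setIUl cardsU !card_set1I setIACA.
suff /eqP->: [set x] :&: [set y] == set0 by rewrite set0I cards0 subn0.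
by rewrite setI_eq0 disjoints1 inE.
Qed.

(** The two equations say that the scale does not distinguish the pans under
    the exchange of [x] and [y]: the coins are on opposite pans or both off. *)
Lemma weigh_pair_balanced x y L R :
    x != y -> (x \in L) = (y \in R) -> (x \in R) = (y \in L) ->
  weigh [set x; y] (L, R) = Balanced.
Proof.
move=> neq_xy xL xR; apply/weigh_balancedE.
by rewrite !card_set2I // xL xR addnC.
Qed.

Lemma weigh_single_tips x L R :
  (x \in L) != (x \in R) -> weigh [set x] (L, R) <> Balanced.
Proof.
move=> tips /weigh_balancedE; rewrite !card_set1I.
by move: tips; do 2!case: (x \in _).
Qed.

End Coins.

Theorem lemma9 (t : nat) (T : finType) (A A' B B' C C' F : {set T})
  (t_gt7 : 7 < t) (t_odd : odd t) (cardT : #|T| = t)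
  (piles : divided_into [:: A; A'; B; B'; C; C'])
  (cardA : #|A| = t./2 - 2) (cardA' : #|A'| = t./2 - 3)
  (cardB : #|B| = 1) (cardB' : #|B'| = 2)
  (cardC : #|C| = 2) (cardC' : #|C'| = 1)
  (fakes : one_in_each F A A' \/ one_in_each F B B' \/ one_in_each F C C') :
  discreet_strategy t 2 1 F
    [:: (A :|: B, A' :|: B'); (B :|: C, B' :|: C')].
Proof.
have pile1 c : (c \in A) + ((c \in A') + ((c \in B) + ((c \in B') +
    ((c \in C) + (c \in C'))))) = 1.
  by rewrite -(count_divided_into c piles) /= addn0.
set ws := [:: _; _].
pose paired (S : {set T}) :=
  one_in_each S A A' \/ one_in_each S B B' \/ one_in_each S C C'.
have paired_fakes S : paired S ->
    #|S| = 2 /\ forall w, w \in ws -> weigh S w = Balanced.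
  move=> pairS; suff [x [y [neq_xy -> opp1 opp2]]]: exists x y,
      [/\ x != y, S = [set x; y],
          (x \in A :|: B) = (y \in A' :|: B')
            /\ (x \in A' :|: B') = (y \in A :|: B)
        & (x \in B :|: C) = (y \in B' :|: C')
            /\ (x \in B' :|: C') = (y \in B :|: C)].
    split=> [|w]; first by rewrite cards2 neq_xy.
    by rewrite !inE => /orP[]/eqP->; apply: weigh_pair_balanced;
      case: opp1 opp2 => ? ? [].
  case: pairS => [|[]] [x [y [xX yX ->]]]; exists x, y;
    rewrite !inE; have := pile1 x; have := pile1 y; rewrite xX yX;
    (have [eq_xy|_] := eqVneq x y; first by
      have := pile1 x; rewrite xX eq_xy yX; lia);
    do 5!case: (y \in _) => //; do 5!case: (x \in _) => //.
have consistentP S : paired S -> #|S| = 2 /\ consistent F ws S.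
  move=> /paired_fakes[cardS balS]; split=> // w w_ws.
  by have [_ balF] := paired_fakes F fakes; rewrite balS ?balF.
(* The smaller of the two large piles, A', is nonempty by this bound. *)
have half_t : 4 <= t./2 by lia.
split; first split=> //; first by case: (paired_fakes F fakes).
- move=> w; rewrite !inE => /orP[]/eqP->; apply: legal_weighing_unions;
    try lia; move=> c; have := pile1 c; lia.
- move=> S /eqP/cards1P[x ->] consS.
  have [_ balF] := paired_fakes F fakes.
  have bal w : w \in ws -> weigh [set x] w = Balanced.
    by move=> w_ws; rewrite consS ?balF.
  (* B and B' are weighed twice, the other piles once. *)
  have [tips|tips] : (x \in A :|: B) != (x \in A' :|: B')
      \/ (x \in B :|: C) != (x \in B' :|: C').
    by have := pile1 x; rewrite !inE; do 6!case: (x \in _) => //; auto.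
  + by apply: (weigh_single_tips tips); apply: bal; rewrite !inE eqxx.
  + by apply: (weigh_single_tips tips); apply: bal; rewrite !inE eqxx orbT.
have [a Aa] : exists a, a \in A by apply/card_gt0P; lia.
have [a' Aa'] : exists a, a \in A' by apply/card_gt0P; lia.
have [b Bb] : exists b, b \in B by apply/card_gt0P; lia.
have [b' Bb'] : exists b, b \in B' by apply/card_gt0P; lia.
have [c Cc] : exists c, c \in C by apply/card_gt0P; lia.
have [c' Cc'] : exists c, c \in C' by apply/card_gt0P; lia.
move=> z; split.
  suff [S pairS zS] : exists2 S, paired S & z \in S.
    by exists S; have [] := consistentP S pairS.
  have : [|| z \in A, z \in A', z \in B, z \in B', z \in C | z \in C'].
    by have := pile1 z; do 6!case: (z \in _).
  case/or4P=> [Az|Az|Bz|/or3P[Bz|Cz|Cz]].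
  - by exists [set z; a']; [left; exists z, a' | rewrite !inE eqxx].
  - by exists [set a; z]; [left; exists a, z | rewrite !inE eqxx orbT].
  - by exists [set z; b']; [right; left; exists z, b' | rewrite !inE eqxx].
  - by exists [set b; z]; [right; left; exists b, z | rewrite !inE eqxx orbT].
  - by exists [set z; c']; [right; right; exists z, c' | rewrite !inE eqxx].
  - by exists [set c; z]; [right; right; exists c, z | rewrite !inE eqxx orbT].
suff [S pairS zS] : exists2 S, paired S & z \notin S.
  by exists S; have [] := consistentP S pairS.
have avoid (X Y : {set T}) x y : x \in X -> y \in Y ->
    z \notin X -> z \notin Y -> z \notin [set x; y].
  move=> Xx Yy /memPn/(_ x Xx) neq_xz /memPn/(_ y Yy) neq_yz.
  by rewrite !inE !(eq_sym z) negb_or neq_xz.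
(* The fakes can be in B and B' unless z is, and then in A and A'. *)
have [zB|/norP[zB zB']] := boolP ((z \in B) || (z \in B')); last first.
  by exists [set b; b']; [right; left; exists b, b' | apply: avoid zB zB'].
exists [set a; a']; first by left; exists a, a'.
by apply: avoid Aa Aa' _ _; have := pile1 z; move: zB; do 6!case: (z \in _).
Qed.
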